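(* For every finite simple graph $G$, the degree of $Q(G;x,y)$ with respect to $y$ equals the independence number $\alpha(G)$ (the maximum cardinality of an independent vertex set of $G$).
   Context: For $G=(V,E)$, $Q(G;x,y)=\sum_{X\subseteq V}x^{|X|}y^{k(G[X])}$, where $G[X]$ is the induced subgraph and $k$ the number of connected components (the null graph has $k=0$). *)

(* Defs.v *)
From mathcomp Require Import all_boot all_order all_algebra.
From mathcomp Require Import polyXY.

Set Implicit Arguments.
Unset Strict Implicit.
Unset Printing Implicit Defensive.

Import GRing.Theory.
Local Open Scope ring_scope.

Record sgraph := SGraph {
  vertex :> finType;
  adj : rel vertex;
  adj_sym : symmetric adj;
  adj_irrefl : irreflexive adj }.

Section InducedSubgraph.

Variables (G : sgraph) (X : {set G}).

Definition induced_adj : rel {x : G | x \in X} :=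
  fun u v => adj (val u) (val v).

Fact induced_adj_sym : symmetric induced_adj.
Proof. by move=> u v; apply: adj_sym. Qed.

Fact induced_adj_irrefl : irreflexive induced_adj.
Proof. by move=> u; apply: adj_irrefl. Qed.

Definition induced : sgraph := SGraph induced_adj_sym induced_adj_irrefl.

End InducedSubgraph.

Definition ncomponents (G : sgraph) : nat := n_comp (@adj G) G.

(* As in polyXY, a polynomial in x and y has type {poly {poly int}}, where
   'X is x and 'Y, i.e. 'X%:P, is y. *)
Definition Qpoly (G : sgraph) : {poly {poly int}} :=
  \sum_(X : {set G}) 'X ^+ #|X| * 'Y ^+ ncomponents (induced X).

Definition independent (G : sgraph) (S : {set G}) : bool :=
  [forall u in S, forall v in S, ~~ adj u v].

Definition independence_number (G : sgraph) : nat :=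
  \max_(S : {set G} | independent S) #|S|.

(* Main.v *)
(* One vertex from each component of [G[X]] gives an independent set of size
   [k(G[X])], so no exponent of [y] exceeds the independence number [a].
   Conversely an independent set [S] of size [a] has [k(G[S]) = a], so the
   monomial [x^a y^a] occurs, and as all coefficients are nonnegative it cannot
   cancel. *)
Require Import Defs.
From mathcomp Require Import all_boot all_order all_algebra.
From mathcomp Require Import polyXY.

Set Implicit Arguments.
Unset Strict Implicit.
Unset Printing Implicit Defensive.

Import GRing.Theory Num.Theory.
Local Open Scope ring_scope.

Lemma adj_connect_sym (G : sgraph) : connect_sym (@adj G).
Proof. by apply: sym_connect_sym; apply: adj_sym. Qed.

(** Adjacent vertices share a component, hence a root; two adjacent roots would thus be equal,
    contradicting irreflexivity. *)
Lemma independent_roots (G : sgraph) (X : {set G}) :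
  independent [set val u | u : induced X in roots (@adj (induced X))].
Proof.
apply/'forall_implyP => _ /imsetP[u /eqP root_u ->].
apply/'forall_implyP => _ /imsetP[v /eqP root_v ->].
apply/negP => uv.
have cuv : connect (@adj (induced X)) u v by apply: connect1.
move/(fingraph.rootP (@adj_connect_sym _)): cuv; rewrite root_u root_v => euv.
by move: uv; rewrite euv adj_irrefl.
Qed.

Lemma ncomponents_le_independence_number (G : sgraph) (X : {set G}) :
  (ncomponents (induced X) <= independence_number G)%N.
Proof.
apply: leq_trans (leq_bigmax_cond _ (independent_roots X)).
rewrite card_imset; last exact: val_inj.
by apply: subset_leq_card; apply/subsetP => u /andP[].
Qed.

Lemma ncomponents_independent (G : sgraph) (S : {set G}) :
  independent S -> ncomponents (induced S) = #|S|.
Proof.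
move=> indepS.
have noedge (u v : induced S) : induced_adj u v = false.
  apply/negbTE.
  by move/'forall_implyP/(_ _ (valP u))/'forall_implyP/(_ _ (valP v)): indepS.
rewrite -[RHS]card_sig; apply: eq_card => u; rewrite !inE andbT.
apply/eqP.
(* A nonempty path from [u] to its root would begin with an edge, so [u] is its own root. *)
have /connectP[[|v p] /=] := connect_root (@adj (induced S)) u.
  by [].
by rewrite noedge.
Qed.

Lemma coef_Qpoly (G : sgraph) (i j : nat) :
  (Qpoly G)`_i`_j =
  \sum_(X : {set G}) ((i == #|X|) && (j == ncomponents (induced X)))%:R.
Proof.
rewrite /Qpoly !coef_sum; apply: eq_bigr => X _.
rewrite -polyC_exp coefMC coefXn.
by case: eqP => _; rewrite ?mul0r ?coef0 // mul1r coefXn.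
Qed.

(* [sizeY p] is 1 plus the degree of [p] in y if [p != 0], and 0 if [p = 0]. *)
Theorem theorem4p2 (G : sgraph) :
  sizeY (Qpoly G) = (independence_number G).+1.
Proof.
apply/eqP; rewrite eqn_leq; apply/andP; split.
  apply/bigmax_leqP => i _; apply/leq_sizeP => j lt_j.
  rewrite coef_Qpoly big1 // => X _; case: (j =P _) => [ej|]; last by rewrite andbF.
  by move: lt_j; rewrite ej ltnNge ncomponents_le_independence_number.
(* A maximum is attained only over a nonempty family; [set0] provides a member. *)
have indep0 : independent (set0 : {set G}).
  by apply/'forall_implyP => u; rewrite inE.
have [|S indepS cardS] := @eq_bigmax_cond _ (@independent G) (fun S => #|S|).
  by apply/card_gt0P; exists set0.
rewrite /independence_number cardS.
have coef_gt0 : 0 < (Qpoly G)`_#|S|`_#|S|.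
  rewrite coef_Qpoly (bigD1 S) //= ncomponents_independent // eqxx /=.
  by rewrite ltr_pwDl // sumr_ge0.
have size_coef : (#|S| < size ((Qpoly G)`_#|S|)%R)%N.
  by rewrite ltnNge; apply: contraTN coef_gt0 => /leq_sizeP ->.
(* [sizeY] takes a maximum over indices below [size (Qpoly G)], so [#|S|] must be in range; beyond
   it coefficients are 0. *)
have lt_size : (#|S| < size (Qpoly G))%N.
  rewrite ltnNge; apply: contraTN size_coef => /leq_sizeP -> //.
  by rewrite size_poly0.
exact: leq_trans size_coef (leq_bigmax (Ordinal lt_size)).
Qed.
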